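(* For every integer $n\ge3$, the domination number of the Sierpiński gasket graph $S_n$ is $\gamma_n=3^{n-2}$. No minimum dominating set $D$ of $S_n$ contains a corner vertex, so that such a $D$ covers, counted with multiplicity, a total of $\sum_{v\in D}(\deg(v)+1)=5\cdot 3^{n-2}$ vertices. Consequently the efficiency of domination, $|V(S_n)|/(5\cdot3^{n-2})$, tends to $9/10$ as $n\to\infty$.
   Context: The Sierpiński gasket graph $S_n$ ($n\ge1$) is the finite simple graph whose vertices are the intersection points of the line segments in the $n$-th finite stage of the Sierpiński gasket and whose edges are the segments joining consecutive such points. Equivalently, it is defined recursively as follows. $S_1$ is a triangle ($K_3$), with its three vertices designated as the top, left and right corner vertices. For $n\ge1$, $S_{n+1}$ is obtained from three disjoint copies $S_{n+1,T}$ (top), $S_{n+1,L}$ (bottom left), $S_{n+1,R}$ (bottom right) of $S_n$ by identifying the left corner of $S_{n+1,T}$ with the top corner of $S_{n+1,L}$, the right corner of $S_{n+1,T}$ with the top corner of $S_{n+1,R}$, and the right corner of $S_{n+1,L}$ with the left corner of $S_{n+1,R}$. The top, left and right corners of $S_{n+1}$ are the top corner of $S_{n+1,T}$, the left corner of $S_{n+1,L}$ and the right corner of $S_{n+1,R}$, respectively; the corner vertices are exactly the degree-two vertices. A dominating set is a set $D$ of vertices such that every vertex is in $D$ or adjacent to a vertex of $D$; a minimum dominating set is one of smallest size, and the domination number $\gamma_n$ is that size. A vertex $v$ covers itself and its neighbours, i.e. $\deg(v)+1$ vertices. *)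

(* Defs.v *)
From mathcomp Require Import all_boot all_order all_algebra reals.
Import Order.TTheory GRing.Theory Num.Theory.

Set Implicit Arguments.
Unset Strict Implicit.
Unset Printing Implicit Defensive.

Local Open Scope nat_scope.

(* A finite graph with three designated corners, indexed by
   0 = top, 1 = left, 2 = right. The adjacency relation is not required here
   to be symmetric and irreflexive, nor the corners to be distinct; both hold
   for the triangle and are preserved by the gluing below. *)
Record cornered_graph := CorneredGraph {
  vertex :> finType;
  adj : rel vertex;
  corner : 'I_3 -> vertex }.

Section Domination.
Variable G : cornered_graph.
Implicit Types (v : G) (D : {set G}).

Definition degree v : nat := #|[set w | adj v w]|.

Definition dominating D : bool :=
  [forall v, (v \in D) || [exists u in D, adj u v]].

Definition minimum_dominating D : Prop :=
  dominating D /\ forall D' : {set G}, dominating D' -> #|D| <= #|D'|.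

Definition domination_number : nat :=
  #|[arg min_(D < [set: G] | dominating D) #|D|]|.

Definition total_cover D : nat := \sum_(v in D) (degree v + 1).

Definition efficiency (R : realType) D : R :=
  (#|G|%:R / (total_cover D)%:R)%R.

End Domination.

Definition triangle : cornered_graph :=
  @CorneredGraph 'I_3 (fun i j => i != j) id.

Section Glue.
Variable G : cornered_graph.

(* Three disjoint copies of G; (i, v) is the vertex v of the i-th copy. *)
Notation copies := ('I_3 * G)%type.

(* Corner j of copy i is identified with corner i of copy j; the three cases
   i != j are the three gluings, and i = j identifies nothing new. *)
Definition ident : rel copies :=
  fun u v => (u.2 == corner G v.1) && (v.2 == corner G u.1).

(* The vertices after gluing are the classes of the equivalence relation
   generated by ident (which is symmetric). *)
Definition class_of (u : copies) : {set copies} :=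
  [set v | connect ident u v].

Definition glue_vertex :=
  {B : {set copies} | B \in [set class_of u | u : copies]}.

Lemma class_ofP u : class_of u \in [set class_of u | u : copies].
Proof. exact: imset_f. Qed.

Definition glue_class u : glue_vertex := exist _ (class_of u) (class_ofP u).

Definition glue_adj : rel glue_vertex := fun A B =>
  [exists u in val A, [exists v in val B, (u.1 == v.1) && adj u.2 v.2]].

Definition glue : cornered_graph :=
  @CorneredGraph glue_vertex glue_adj (fun i => glue_class (i, corner G i)).

End Glue.

(* Meaningful for n >= 1; gasket 1 is the triangle, and gasket 0 is a junk
   value. *)
Definition gasket (n : nat) : cornered_graph := iter n.-1 glue triangle.

(* Main.v *)
(* Lower bound: the three middle vertices of a copy of S_2 are dominated from
   within that copy, by one of themselves or by at least two of its corners.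
   Splitting the weight of a shared corner evenly, each of the 3^(n-2) copies of
   S_2 thus carries weight at least 1 while a corner of S_n only contributes
   one half, so 2|D| >= 2 * 3^(n-2) + (number of corners of S_n in D). Upper
   bound: three vertices dominate S_3, and copies of a dominating set of S_n
   dominate S_(n+1). Equality forces the corners out of a minimum dominating
   set, and all other vertices have degree four. *)

From mathcomp Require Import all_boot all_order all_algebra.
From mathcomp Require Import all_classical all_reals all_analysis.
From mathcomp Require Import zify ring lra.
Require Import Defs.

Set Implicit Arguments.
Unset Strict Implicit.
Unset Printing Implicit Defensive.

(** * Counting over pairs and over three indices *)

Lemma card_pair_set (I T : finType) (F : I -> pred T) :
  #|[set p : I * T | F p.1 p.2]| = \sum_i #|[set t | F i t]|.
Proof.
rewrite -sum1dep_card -(pair_big_dep xpredT F (fun _ _ => 1)) /=.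
by apply: eq_bigr => i _; rewrite sum1dep_card.
Qed.

Lemma sum_ord3 (F : 'I_3 -> nat) : \sum_i F i = F 0%R + F 1%R + F 2%R.
Proof.
rewrite 3!big_ord_recl big_ord0 addn0 addnA.
by congr (F _ + F _ + F _); apply: val_inj.
Qed.

Lemma card_ord3 (P : pred 'I_3) : #|[set i | P i]| = P 0%R + P 1%R + P 2%R.
Proof.
rewrite -sum1dep_card big_mkcond sum_ord3.
by case: (P 0%R); case: (P 1%R); case: (P 2%R).
Qed.

Lemma forall_ord3 (P : 'I_3 -> Prop) : P 0%R -> P 1%R -> P 2%R -> forall i, P i.
Proof.
move=> P0 P1 P2 [[|[|[|//]]] lti].
- by rewrite (_ : Ordinal _ = 0%R) //; apply: val_inj.
- by rewrite (_ : Ordinal _ = 1%R) //; apply: val_inj.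
by rewrite (_ : Ordinal _ = 2%R) //; apply: val_inj.
Qed.

(** * Copies, traces and seam vertices of a glued graph *)

Definition is_corner (G : cornered_graph) (v : G) :=
  [exists i, v == corner G i].

Definition dominates (G : cornered_graph) (D : {set G}) (v : G) : bool :=
  (v \in D) || [exists u in D, adj u v].

Definition corner_count (G : cornered_graph) (D : {set G}) : nat :=
  #|[set i | corner G i \in D]|.

Definition copy (G : cornered_graph) (i : 'I_3) (v : G) : glue G :=
  glue_class (i, v).

Definition trace (G : cornered_graph) (D : {set glue G}) (i : 'I_3) : {set G} :=
  [set v | copy i v \in D].

(** A seam vertex is a point where two copies are glued; the condition [j < i] counts it once, from
    the copy of larger index. *)
Definition seam_count (G : cornered_graph) (D : {set glue G}) : nat :=
  \sum_(i < 3) #|[set j : 'I_3 | (j < i) && (copy i (corner G j) \in D)]|.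

Section Glue.
Variable G : cornered_graph.
Hypothesis corner_inj : injective (corner G).
Implicit Types (v w : G) (D : {set glue G}) (A B : glue G).

Lemma identC : symmetric (@ident G).
Proof. by move=> u v; rewrite /ident andbC. Qed.

Lemma connect_identC : connect_sym (@ident G).
Proof. exact: sym_connect_sym identC. Qed.

(** Chains of identifications collapse: if (i, a) ~ (j, b) ~ (k, c), then b is both corner i and
    corner k, so i = k by injectivity and c = a. Hence classes have at most two elements. *)
Lemma glue_classP (u v : 'I_3 * G) :
  reflect (u = v \/ ident u v) (glue_class u == glue_class v).
Proof.
have connectE (u1 v1 : 'I_3 * G) :
    connect (@ident G) u1 v1 -> u1 = v1 \/ ident u1 v1.
  case/connectP=> p; elim: p u1 => [|w p IHp] u1 /= => [_ ->|]; first by left.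
  case/andP=> uw /IHp IH /IH{IH IHp} [<-|wv]; [by right | left].
  case: u1 w v1 uw wv => [i a] [j b] [k c] /andP[/= /eqP-> /eqP->].
  by case/andP=> /= /eqP/corner_inj-> /eqP->.
apply: (iffP eqP) => [/(congr1 val)/setP/(_ v) /=|].
  by rewrite !inE connect0 => /connectE.
case=> [->//|uv]; apply: val_inj; apply/setP => w /=; rewrite !inE.
exact: (same_connect connect_identC (connect1 uv)).
Qed.

Lemma copyP i v j w :
  reflect ((i = j /\ v = w) \/ (v = corner G j /\ w = corner G i))
          (copy i v == copy j w).
Proof.
apply: (iffP (glue_classP _ _)).
  by case=> [[-> ->]|/andP[/= /eqP-> /eqP->]]; [left|right].
by case=> [[-> ->]|[-> ->]]; [left|right; rewrite /ident /= !eqxx].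
Qed.

Lemma copy_inj i : injective (@copy G i).
Proof. by move=> v w /eqP/copyP [[]|[-> ->]]. Qed.

Lemma copy_corner i j : copy i (corner G j) = copy j (corner G i).
Proof. by apply/eqP/copyP; right. Qed.

Lemma copy_surj A : exists i v, A = copy i v.
Proof.
case: A => B memB; have [[i v] _ defB] := imsetP memB.
by exists i, v; apply: val_inj.
Qed.

(** The hypothesis says that v is an inner vertex or corner i itself, which are the vertices of copy
    i that no other copy shares. *)
Lemma copy_unshared i v j w : (forall k, v = corner G k -> k = i) ->
  copy i v = copy j w -> i = j /\ v = w.
Proof.
by move=> vi /eqP/copyP[//|[def_v ->]]; have ji := vi j def_v; rewrite def_v ji.
Qed.

Lemma mem_glue_class (u : 'I_3 * G) A : u \in val A -> A = glue_class u.
Proof.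
case: A => B memB; have [w _ defB] /= := imsetP memB.
move=> Bu; apply: val_inj => /=; move: Bu; rewrite defB inE => cwu.
by apply/setP => z; rewrite !inE (same_connect connect_identC cwu).
Qed.

Lemma glue_adjP A B :
  reflect (exists i v w, [/\ A = copy i v, B = copy i w & adj v w])
          (@adj (glue G) A B).
Proof.
apply: (iffP existsP) => [[[i v] /andP[Au /existsP[[j w]]]]|].
  case/and3P=> Bw /= /eqP eij vw; rewrite -{j}eij in Bw.
  by exists i, v, w; rewrite (mem_glue_class Au) (mem_glue_class Bw).
case=> i [v [w [-> -> vw]]]; exists (i, v); rewrite inE connect0 /=.
by apply/existsP; exists (i, w); rewrite inE connect0 /= eqxx.
Qed.

Lemma adj_copy i v w : adj v w -> adj (copy i v) (copy i w).
Proof. by move=> vw; apply/glue_adjP; exists i, v, w. Qed.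

Lemma corner_glue_inj : injective (corner (glue G)).
Proof. by move=> i j /eqP/copyP [[]|[/corner_inj]]. Qed.

Lemma is_corner_copy i v : is_corner (copy i v) = (v == corner G i).
Proof.
apply/existsP/eqP => [[j /copyP[[-> ->]//|[-> /corner_inj ->//]]]|->].
by exists i.
Qed.

(** * Counting vertices and corners over the three copies *)

Lemma sum_card_trace D :
  \sum_i #|trace D i| = #|D| + seam_count D.
Proof.
(* Of the two representatives of a seam vertex, [high] selects the one lying
   in the copy of larger index. *)
pose high := [set u : 'I_3 * G |
  [exists j : 'I_3, (j < u.1) && (u.2 == corner G j)]].
pose P := [set u : 'I_3 * G | copy u.1 u.2 \in D].
have -> : \sum_i #|trace D i| = #|P|.
  by rewrite /P (card_pair_set (fun i v => copy i v \in D)).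
rewrite -(cardsID high P) addnC; congr (_ + _).
  rewrite -(card_in_imset (f := @glue_class G)); last first.
    move=> [i v] [j w]; rewrite !inE /=.
    case/andP=> /existsPn hv _ /andP[/existsPn hw _] /eqP/glue_classP.
    case=> // /andP[/= /eqP dv /eqP dw]; rewrite {}dv {}dw in hv hw *.
    have := hv j; have := hw i; rewrite !eqxx !andbT -!leqNgt => ij ji.
    by have -> : i = j by apply: val_inj; apply/eqP; rewrite eqn_leq ij ji.
  congr #|pred_of_set _|; apply/setP=> A.
  apply/imsetP/idP => [[[i v]]|AD]; first by rewrite !inE => /andP[_ Du ->].
  have [i [v defA]] := copy_surj A; rewrite {}defA in AD *.
  case hiv: ((i, v) \in high); last by
    exists (i, v); rewrite ?finset.in_setD ?hiv ?inE.
  move: hiv; rewrite inE => /existsP[/= j /andP[lt_ji /eqP dv]].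
  rewrite {}dv in AD *.
  (* The other representative of this seam vertex lies in the lower copy [j], hence outside
     [high]. *)
  exists (j, corner G i); last exact: copy_corner.
  rewrite finset.in_setD [_ \in P]inE /= -copy_corner AD andbT inE.
  apply/existsPn => k /=; apply/negP => /andP[lt_kj /eqP/corner_inj eik].
  by move: (ltn_trans lt_kj lt_ji); rewrite -eik ltnn.
(* The representatives in [high] are matched with the index pairs j < i. *)
rewrite /seam_count -(card_pair_set (fun i j : 'I_3 =>
  (j < i) && (copy i (corner G j) \in D))).
rewrite -(card_imset (f := fun p : 'I_3 * 'I_3 => (p.1, corner G p.2)));
  last first.
  by move=> [i j] [k l] /= [-> /corner_inj ->].
congr #|pred_of_set _|; apply/setP => -[i v]; rewrite !inE.
apply/andP/imsetP => [[vD /existsP[j /andP[/= ltji /eqP dv]]]|[[k l]]].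
  by exists (i, j); rewrite ?inE /= ?ltji -?dv.
rewrite !inE /= => /andP[lt_lk inD] [-> ->]; split=> //.
by apply/existsP; exists l; rewrite lt_lk /=.
Qed.

(** Of the nine pairs (copy, corner), three give the corners of the glued graph and the other six
    give each seam vertex twice. *)
Lemma sum_corner_count_trace D :
  \sum_i corner_count (trace D i) = corner_count D + 2 * seam_count D.
Proof.
have -> : corner_count D = #|[set i | copy i (corner G i) \in D]| by [].
rewrite /seam_count /corner_count !sum_ord3 !card_ord3 !inE.
rewrite /= (copy_corner 1%R 0%R) (copy_corner 2%R 0%R) (copy_corner 2%R 1%R).
by lia.
Qed.

(** Both counts are applied to the full vertex set: the corner count 9 = 3 + 2 * 3 shows that there
    are three seam vertices. *)
Lemma card_glue : #|glue G| + 3 = 3 * #|G|.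
Proof.
have := sum_card_trace [set: glue G].
have -> : \sum_i #|trace [set: glue G] i| = 3 * #|G|.
  rewrite (eq_bigr (fun=> #|G|)) ?sum_nat_const ?card_ord // => i _.
  by rewrite -cardsT; congr #|pred_of_set _|; apply/setP => v; rewrite !inE.
have := sum_corner_count_trace [set: glue G].
have cT (H : cornered_graph) (E : {set H}) :
    (forall v : H, v \in E) -> corner_count E = 3.
  move=> ET; rewrite -[RHS]card_ord -cardsT; congr #|pred_of_set _|.
  by apply/setP => i; rewrite !inE ET.
rewrite (eq_bigr (fun=> 3)) => [|i _]; last by apply: cT => v; rewrite !inE.
rewrite cT ?sum_nat_const ?card_ord => [|v]; last by rewrite inE.
by rewrite cardsT; lia.
Qed.

(** * Domination and degrees under gluing *)

Lemma dominates_trace D i v : ~~ is_corner v ->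
  dominates D (copy i v) -> dominates (trace D i) v.
Proof.
move=> ncv /orP[vD|/exists_inP[A AD /glue_adjP[j [u [w [defA eqvw uw]]]]]].
  by rewrite /dominates inE vD.
have [|eij evw] := copy_unshared _ eqvw.
  by move=> k vk; case/existsP: ncv; exists k; rewrite vk.
rewrite {}defA -eij in AD.
by apply/orP; right; apply/exists_inP; exists u; rewrite ?inE // evw.
Qed.

Lemma dominates_copy D i (E : {set G}) v : {subset E <= trace D i} ->
  dominates E v -> dominates D (copy i v).
Proof.
move=> sED /orP[/sED|/exists_inP[u /sED uD uv]].
  by rewrite inE /dominates => ->.
apply/orP; right; apply/exists_inP; exists (copy i u); last exact: adj_copy.
by rewrite inE in uD.
Qed.

Lemma degree_copy i v : (forall k, v = corner G k -> k = i) ->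
  degree (copy i v) = degree v.
Proof.
move=> vi; rewrite /degree -(card_imset _ (@copy_inj i)).
congr #|pred_of_set _|; apply/setP => A; rewrite inE.
apply/glue_adjP/imsetP => [[j [u [w [eqv -> uw]]]]|[w]].
  by have [-> ->] := copy_unshared vi eqv; exists w; rewrite ?inE.
by rewrite inE => vw ->; exists i, v, w.
Qed.

(** The neighbourhoods in copies i and j are disjoint, since the copies meet only in the seam
    vertex, which is not its own neighbour. *)
Lemma degree_seam i j : irreflexive (@adj G) -> i != j ->
  degree (copy i (corner G j)) = degree (corner G i) + degree (corner G j).
Proof.
move=> irrG neq_ij; rewrite /degree addnC.
rewrite -(card_imset _ (@copy_inj i))
  -(card_imset [set w | adj (corner G i) w] (@copy_inj j)).
rewrite -cardsUI [X in _ + #|pred_of_set X|](_ : _ = finset.set0) ?cards0 ?addn0;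
  last first.
  apply/setP => A; rewrite !inE; apply/negP => /andP[/imsetP[v]].
  rewrite inE => jv -> /imsetP[w]; rewrite inE => iw /eqP/copyP[[/eqP]|[vj _]].
    by rewrite (negPf neq_ij).
  by rewrite vj irrG in jv.
congr #|pred_of_set _|; apply/setP => A; rewrite !inE.
apply/glue_adjP/orP => [[k [u [w [/eqP/copyP eqv -> uw]]]]|].
  case: eqv => [[-> eju]|[/corner_inj -> eiu]]; [left|right].
    by apply/imsetP; exists w; rewrite // inE eju.
  by apply/imsetP; exists w; rewrite // inE -eiu.
case=> /imsetP[w]; rewrite inE => vw ->; first by exists i, (corner G j), w.
by exists j, (corner G i), w; split=> //; apply: copy_corner.
Qed.

End Glue.

(** The invariant carried through the gluing: a seam vertex joins two corners of degree 2 and so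
    becomes an inner vertex of degree 4. *)
Record gasket_like (G : cornered_graph) : Prop := GasketLike {
  gl_corner_inj : injective (corner G);
  gl_irreflexive : irreflexive (@adj G);
  gl_degree_corner : forall i, degree (corner G i) = 2;
  gl_degree_inner : forall v : G, ~~ is_corner v -> degree v = 4 }.

Lemma triangle_gasket_like : gasket_like triangle.
Proof.
split=> [i j //|i|i|v]; first by rewrite /= eqxx.
  rewrite -[RHS]/(3.-1) -[in RHS](card_ord 3) -(cardsC1 (corner triangle i)).
  by congr #|pred_of_set _|; apply/setP => j; rewrite !inE eq_sym.
by case/existsP; exists v.
Qed.

Lemma glue_gasket_like (G : cornered_graph) :
  gasket_like G -> gasket_like (glue G).
Proof.
case=> injG irrG deg2 deg4; split=> [|A|i|A ncA].
- exact: corner_glue_inj.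
- apply/negbTE/negP => /glue_adjP[i [v [w [-> /(copy_inj injG) <-]]]].
  by rewrite irrG.
- by rewrite -[corner _ i]/(copy i (corner G i)) degree_copy // => k /injG.
have [i [v defA]] := copy_surj A; rewrite {}defA is_corner_copy // in ncA *.
case cv: (is_corner v); last first.
  rewrite degree_copy ?deg4 ?cv // => k vk.
  by case/existsP: cv; exists k; rewrite vk.
case/existsP: cv => j /eqP dv; rewrite {}dv in ncA *.
by rewrite degree_seam ?deg2 //; apply: contraNneq ncA => ->.
Qed.

(** * Lower bound *)

(** Corners are exempt because a corner of a copy may be dominated from another copy; this weaker
    condition passes to traces. *)
Definition inner_dominating (G : cornered_graph) (D : {set G}) :=
  forall v : G, ~~ is_corner v -> dominates D v.

Lemma inner_dominating_trace (G : cornered_graph) (D : {set glue G}) i :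
  injective (corner G) -> inner_dominating D -> inner_dominating (trace D i).
Proof.
move=> injG domD v ncv; apply: dominates_trace => //; apply: domD.
rewrite is_corner_copy //; apply: contraNneq ncv => ->.
by apply/existsP; exists i.
Qed.

(* [2 * #|D| - corner_count D] is twice the weight of [D] when corners weigh 1/2
   and other vertices 1, which makes the weight additive over the copies. *)
Definition half_weight_bound (G : cornered_graph) k :=
  forall D : {set G}, inner_dominating D -> 2 * k + corner_count D <= 2 * #|D|.

(** When the bounds for the three traces are added, [2 * seam_count D] appears on both sides and
    cancels. *)
Lemma half_weight_bound_glue (G : cornered_graph) k :
  injective (corner G) -> half_weight_bound G k ->
  half_weight_bound (glue G) (3 * k).
Proof.
move=> injG bound D domD.
have bt i : 2 * k + corner_count (trace D i) <= 2 * #|trace D i|.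
  by apply: bound; apply: inner_dominating_trace.
have := sum_card_trace injG D; have := sum_corner_count_trace injG D.
rewrite !sum_ord3; move: (bt 0%R) (bt 1%R) (bt 2%R); lia.
Qed.

Lemma half_weight_bound_glue_triangle : half_weight_bound (glue triangle) 1.
Proof.
have inj3 : injective (corner triangle) by [].
move=> D domD.
(* Copies i and j contain all vertices but the third corner, and whatever dominates their common
   midpoint lies in one of them. *)
have mid i j : i != j ->
    [|| copy i (0%R : triangle) \in D, copy i (1%R : triangle) \in D,
    copy i (2%R : triangle) \in D,
    copy j (0%R : triangle) \in D, copy j (1%R : triangle) \in D
    | copy j (2%R : triangle) \in D].
  move=> neq_ij.
  have /domD/orP dom : ~~ is_corner (copy i (corner triangle j)).
    by rewrite is_corner_copy // eq_sym.
  suff [k [l [/pred2P kij]]] :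
      exists k l, pred2 i j k /\ copy k (l : triangle) \in D.
    by case: kij => ->; elim/forall_ord3: l => ->; rewrite ?orbT.
  case: dom => [|/exists_inP[A AD /glue_adjP[k [u [w [defA eqw _]]]]]].
    by exists i, j; rewrite /= eqxx.
  exists k, u; rewrite -defA; split=> //.
  by move/eqP/(copyP inj3): eqw => [[-> _]|[/= -> _]]; rewrite /= eqxx ?orbT.
have := sum_card_trace inj3 D; have := sum_corner_count_trace inj3 D.
have ccE i : corner_count (trace D i) = #|trace D i|.
  by congr #|pred_of_set _|; apply/setP => j; rewrite inE.
rewrite (eq_bigr _ (fun i _ => ccE i)) => -> eqD.
have defc : corner_count D =
    (copy 0%R (0%R : triangle) \in D) + (copy 1%R (1%R : triangle) \in D) +
    (copy 2%R (2%R : triangle) \in D).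
  exact: card_ord3.
have defs : seam_count D =
    (copy 1%R (0%R : triangle) \in D) + (copy 2%R (0%R : triangle) \in D) +
    (copy 2%R (1%R : triangle) \in D).
  by rewrite /seam_count sum_ord3 !card_ord3; do 9! case: (_ \in D).
(* The three conditions force a midpoint or two corners into [D]; this is checked over all subsets
   of the six vertices. *)
have := mid 0%R 1%R isT; have := mid 0%R 2%R isT; have := mid 1%R 2%R isT.
have E i j : copy i (j : triangle) = copy j (i : triangle).
  by apply: copy_corner.
rewrite (E 0%R 1%R) (E 0%R 2%R) (E 1%R 2%R).
move: eqD; rewrite defc defs; clear.
by do 6! case: (_ \in D); rewrite //=; lia.
Qed.

(** * Upper bound *)

Lemma dominating_glue (G : cornered_graph) (E : {set G}) :
  injective (corner G) -> dominating E ->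
  exists2 D : {set glue G}, dominating D & #|D| <= 3 * #|E|.
Proof.
move=> injG /forallP domE.
exists [set copy p.1 p.2 | p in finset.setX [set: 'I_3] E].
  apply/forallP => A; have [i [v ->]] := copy_surj A.
  apply: dominates_copy (domE v) => u uE; rewrite inE.
  by apply/imsetP; exists (i, u); rewrite ?inE.
by rewrite (leq_trans (leq_imset_card _ _)) // cardsX cardsT card_ord.
Qed.

Lemma dominating_glue_glue_triangle :
  exists2 D : {set glue (glue triangle)}, dominating D & #|D| <= 3.
Proof.
have inj3 : injective (corner triangle) by [].
(* Copy i is dominated by the midpoint of its side {i, i+2}, except for its
   corner i+1, which copy i+1 takes care of. *)
pose m (i : 'I_3) : glue (glue triangle) :=
  copy i (copy i ((i + 2)%R : triangle)).
exists [set m i | i : 'I_3]; last first.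
  by rewrite (leq_trans (leq_imset_card _ _)) ?card_ord.
(* If a small triangle contains [m i], all its vertices are dominated; in copy i this applies to
   triangles i and i+2, which share [m i]. *)
have near (i j k l : triangle) : copy i (copy j k) = m i ->
    dominates [set m i | i : 'I_3] (copy i (copy j l)).
  move=> em; case: (eqVneq k l) => [<-|kl]; rewrite /dominates.
    by rewrite em imset_f.
  apply/orP; right; apply/exists_inP; exists (m i); first exact: imset_f.
  by rewrite -em; do 2!apply: adj_copy.
have swap (i k : triangle) : copy i k = copy k i by apply: copy_corner.
have own (i k : triangle) : dominates [set m i | i : 'I_3] (copy i (copy i k)).
  exact: near.
have prev (i k : triangle) :
    dominates [set m i | i : 'I_3] (copy i (copy (i + 2)%R k)).
  by apply: (near _ _ i); rewrite /m swap.
apply/forallP => A; have [i [v ->]] := copy_surj A.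
have [j [k ->]] := copy_surj v; rewrite -/(dominates _ _).
case: (eqVneq j i) => [->//|ji]; case: (eqVneq j (i + 2)%R) => [->//|ji2].
case: (eqVneq k i) => [->|ki]; first by rewrite swap.
case: (eqVneq k (i + 2)%R) => [->|ki2]; first by rewrite swap.
(* Only j = k = i+1 remains, that is, corner j of copy i. It is also corner i of copy j, in triangle
   i = j+2 of that copy, so [prev] applies. *)
have -> : k = j.
  by move: i j k {v} ji ji2 ki ki2; do 3!apply: forall_ord3.
have ej : i = (j + 2)%R.
  by apply/eqP; move: i j {k v ki ki2} ji ji2; do 2!apply: forall_ord3.
have -> : copy i (copy j (j : triangle)) = copy j (copy i (i : triangle)).
  exact: (@copy_corner (glue triangle) (corner_glue_inj inj3)).
by have := prev j i; rewrite -ej.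
Qed.

(** * The gasket graphs: order, domination number and total cover *)

Lemma gasket_gasket_like n : gasket_like (gasket n).
Proof.
rewrite /gasket; elim: n.-1 => [|m]; first exact: triangle_gasket_like.
exact: glue_gasket_like.
Qed.

Lemma gasketS n : gasket n.+2 = glue (gasket n.+1).
Proof. by []. Qed.

Lemma gasket_corner_inj n : injective (corner (gasket n)).
Proof. exact: gl_corner_inj (gasket_gasket_like n). Qed.

Lemma card_gasket n : 2 * #|gasket n.+1| = 3 ^ n.+1 + 3.
Proof.
elim: n => [|n IHn]; first by rewrite card_ord.
have := card_glue (@gasket_corner_inj n.+1).
by rewrite -gasketS expnS; lia.
Qed.

Lemma half_weight_bound_gasket n : half_weight_bound (gasket n.+2) (3 ^ n).
Proof.
elim: n => [|n IHn]; first exact: half_weight_bound_glue_triangle.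
rewrite expnS gasketS; apply: half_weight_bound_glue IHn.
exact: gasket_corner_inj.
Qed.

(** The induction starts at S_3: no single vertex dominates S_2, which has six vertices of degree at
    most four. *)
Lemma dominating_gasket n :
  exists2 D : {set gasket n.+3}, dominating D & #|D| <= 3 ^ n.+1.
Proof.
elim: n => [|n [E domE leE]]; first exact: dominating_glue_glue_triangle.
have [D domD leD] := dominating_glue (@gasket_corner_inj n.+3) domE.
by exists D; rewrite // expnS (leq_trans leD) // leq_mul2l leE.
Qed.

Lemma dominating_weight n (D : {set gasket n.+2}) : dominating D ->
  2 * 3 ^ n + corner_count D <= 2 * #|D|.
Proof.
by move=> /forallP domD; apply: half_weight_bound_gasket => v _; apply: domD.
Qed.

Lemma domination_number_gasket n : domination_number (gasket n.+3) = 3 ^ n.+1.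
Proof.
rewrite /domination_number; case: arg_minnP => [|D domD minD].
  by apply/forallP => v; rewrite inE.
have [E domE leE] := dominating_gasket n.
have := dominating_weight domD; have := leq_trans (minD _ domE) leE; lia.
Qed.

Lemma minimum_dominating_gasket n (D : {set gasket n.+3}) :
  minimum_dominating D -> #|D| = 3 ^ n.+1 /\ corner_count D = 0.
Proof.
case=> domD minD; have [E domE leE] := dominating_gasket n.
have := dominating_weight domD; have := leq_trans (minD _ domE) leE; lia.
Qed.

Lemma corner_free (G : cornered_graph) (D : {set G}) :
  corner_count D = 0 -> forall i, corner G i \notin D.
Proof.
move=> /eqP; rewrite cards_eq0 => /eqP/setP D0 i.
by have := D0 i; rewrite !inE => ->.
Qed.

Lemma total_cover_corner_free (G : cornered_graph) (D : {set G}) :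
  gasket_like G -> (forall i, corner G i \notin D) -> total_cover D = 5 * #|D|.
Proof.
move=> glG cD; rewrite mulnC -sum_nat_const; apply: eq_bigr => v vD.
rewrite (gl_degree_inner glG) //; apply/existsPn => i.
by apply: contraNneq (cD i) => <-.
Qed.

(** * Limit of the efficiency *)

Import Order.TTheory GRing.Theory Num.Theory.
Import numFieldNormedType.Exports.
Local Open Scope classical_set_scope.
Local Open Scope ring_scope.

Theorem mainTheorem4 (R : realType) :
  (forall n : nat, (3 <= n)%N ->
     domination_number (gasket n) = (3 ^ (n - 2))%N
     /\ forall D : {set gasket n}, minimum_dominating D ->
          [/\ forall i : 'I_3, corner (gasket n) i \notin D,
              total_cover D = (5 * 3 ^ (n - 2))%N
            & efficiency R D = #|gasket n|%:R / (5 * 3 ^+ (n - 2))])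
  /\ (fun n : nat => #|gasket n|%:R / (5 * 3 ^+ (n - 2)) : R) @ \oo
       --> (9 / 10 : R).
Proof.
split=> [[|[|[|n]]] // _|].
  rewrite -[(n.+3 - 2)%N]/n.+1; split=> [|D minD].
    exact: domination_number_gasket.
  have [cardD /corner_free cD] := minimum_dominating_gasket minD.
  have coverD : total_cover D = (5 * 3 ^ n.+1)%N.
    by rewrite total_cover_corner_free ?cardD //; apply: gasket_gasket_like.
  by split=> //; rewrite /efficiency coverD natrM natrX.
(* Shifting by two removes the truncated subtraction in the exponent. *)
rewrite -(cvg_shiftn 2).
(* With q = 3^n, the order of S_(n+2) is (9q + 3)/2; dividing by 5q gives 9/10 + 3/(10q). *)
have -> : [sequence #|gasket (n + 2)|%:R / (5 * 3 ^+ (n + 2 - 2)) : R]_n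
          = (fun n => 9 / 10 + geometric (3 / 10) 3^-1 n).
  apply/funext => n /=; rewrite addnK addn2 exprVn.
  have := congr1 (fun k => k%:R : R) (card_gasket n.+1).
  rewrite natrM natrD natrX !exprS => eqc.
  have : 3 ^+ n != 0 :> R by rewrite expf_neq0 ?pnatr_eq0.
  move: eqc; set c := #|_|%:R; set q := 3 ^+ n => eqc q0.
  have -> : c = (9 * q + 3) / 2 by lra.
  by field.
rewrite -[9 / 10 in X in _ --> X]addr0; apply: cvgD; first exact: cvg_cst.
apply: cvg_geometric; rewrite ger0_norm ?invr_ge0 //.
by rewrite invf_lt1 ?ltr1n // ltr0n.
Qed.
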